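(* Let $\mathcal{U}=\{u_1,\dots,u_N\}$ be a weighted SVD basis of $\mathcal{N}_\Phi(X)$ associated with the cubature rule $(X,\mathcal{W})_N$ on $\Omega$, with singular values $\sigma_1^2,\dots,\sigma_N^2$. Then: 1. for all $1\le j\le N$ and all $x\in\Omega$, $u_j(x)=\frac{1}{\sigma_j^2}\sum_{i=1}^N w_i\,u_j(x_i)\,\Phi(x,x_i)$ (that is, $u_j(x)$ equals $\frac{1}{\sigma_j^2}$ times the value given by the cubature rule $(X,\mathcal{W})_N$ for $\int_\Omega \Phi(x,y)u_j(y)\,dy$); 2. $\mathcal{U}$ is orthonormal with respect to $(\cdot,\cdot)_\Phi$; 3. $\mathcal{U}$ is orthogonal with respect to $(\cdot,\cdot)_{\ell_2^w(X)}$; 4. $\|u_j\|_{\ell_2^w(X)}^2=\sigma_j^2$ for all $u_j\in\mathcal{U}$; 5. $\sum_{j=1}^N\sigma_j^2=\phi(0)\,|\Omega|$.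
   Context: Let $\Omega\subset\mathbb{R}^n$ be a bounded measurable set with Lebesgue measure $|\Omega|$, and let $\Phi:\Omega\times\Omega\to\mathbb{R}$ be a continuous, symmetric, radial kernel, $\Phi(x,y)=\phi(\|x-y\|_2)$ with $\phi:[0,\infty)\to\mathbb{R}$, that is (strictly) positive definite: for all finite sets of pairwise distinct points the matrix of kernel values is positive definite. The native space $\mathcal{N}_\Phi(\Omega)$ is the real Hilbert space of functions on $\Omega$ with reproducing kernel $\Phi$, with inner product $(\cdot,\cdot)_\Phi$ and norm $\|\cdot\|_\Phi$. For a set $X=\{x_1,\dots,x_N\}\subset\Omega$ of pairwise distinct points, $\mathcal{N}_\Phi(X)=\mathrm{span}\{\Phi(\cdot,x_1),\dots,\Phi(\cdot,x_N)\}$ and $A=(\Phi(x_i,x_j))_{1\le i,j\le N}$. A cubature rule $(X,\mathcal{W})_N$ on $\Omega$ consists of such an $X$ and positive weights $\mathcal{W}=\{w_1,\dots,w_N\}$, used to approximate $\int_\Omega f(y)\,dy$ by $\sum_{j=1}^N w_jf(x_j)$; it is assumed exact on constants, i.e. $\sum_{j=1}^N w_j=|\Omega|$. Put $W=\mathrm{diag}(w_1,\dots,w_N)$ and $(f,g)_{\ell_2^w(X)}=\sum_{i=1}^N w_i f(x_i)g(x_i)$, with $\|f\|_{\ell_2^w(X)}^2=(f,f)_{\ell_2^w(X)}$. Weighted SVD basis: let $\sqrt{W}\,A\,\sqrt{W}=Q\,\Sigma^2\,Q^T$ be a singular value decomposition (equivalently, an orthogonal diagonalization), with $Q$ orthogonal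 and $\Sigma=\mathrm{diag}(\sigma_1,\dots,\sigma_N)$, $\sigma_1\ge\dots\ge\sigma_N>0$. The associated weighted SVD basis $\mathcal{U}=\{u_1,\dots,u_N\}$ of $\mathcal{N}_\Phi(X)$ is given by $u_j=\sum_{i=1}^N (C_{\mathcal U})_{ij}\,\Phi(\cdot,x_i)$ with $C_{\mathcal U}=\sqrt{W}\,Q\,\Sigma^{-1}$; equivalently $(u_j(x_i))_{i,j}=\sqrt{W^{-1}}\,Q\,\Sigma$. *)

(* Defs.v *)
From HB Require Import structures.
From mathcomp Require Import all_boot all_order all_algebra.
From mathcomp Require Import all_classical all_reals all_analysis.

Set Implicit Arguments.
Unset Strict Implicit.
Unset Printing Implicit Defensive.

Import Order.TTheory GRing.Theory Num.Theory.
Import numFieldNormedType.Exports.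

Local Open Scope classical_set_scope.
Local Open Scope ring_scope.

Section euclidean_space.
Context {R : realType} {n : nat}.

(* The library norm on 'rV[R]_n is the sup norm, hence this definition; both
   norms induce the same topology and the same bounded sets. *)
Definition enorm (z : 'rV[R]_n) : R := Num.sqrt (\sum_(i < n) z 0 i ^+ 2).

Definition box (a b : 'rV[R]_n) : set 'rV[R]_n :=
  [set z | forall i, a 0 i <= z 0 i < b 0 i].

Definition box_volume (a b : 'rV[R]_n) : R :=
  \prod_(i < n) Num.max 0 (b 0 i - a 0 i).

(* Lebesgue outer measure on R^n, for n > 0, by countable covers with half-open
   boxes. (In dimension 0 no box is empty, so the empty set gets the value +oo.)
   The Lebesgue measurable sets are its Caratheodory measurable sets, on which
   it is the n-dimensional Lebesgue measure. *)
Definition lebesgue_outer (A : set 'rV[R]_n) : \bar R :=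
  ereal_inf [set s | exists a b : nat -> 'rV[R]_n,
    A `<=` \bigcup_k box (a k) (b k) /\
    s = (\sum_(0 <= k <oo) (box_volume (a k) (b k))%:E)%E].

Definition lebesgue_measurable (A : set 'rV[R]_n) : Prop :=
  lebesgue_outer.-caratheodory A.

End euclidean_space.

Definition posdefmx {R : realType} {m : nat} (A : 'M[R]_m) : Prop :=
  A^T = A /\ forall c : 'rV[R]_m, c != 0 -> 0 < (c *m A *m c^T) 0 0.

Definition kernel_mx {R : realType} {T : Type} (K : T -> T -> R) {m : nat}
  (x : 'I_m -> T) : 'M[R]_m := \matrix_(i, j) K (x i) (x j).

(* [Omega] is used as the subtype of its points, with the subspace topology.
   Only the values of [phi] on [0, +oo[ are relevant. *)
Record radial_pd_kernel {R : realType} {n : nat} (Omega : set 'rV[R]_n)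
    (phi : R -> R) (Phi : Omega -> Omega -> R) : Prop := RadialPDKernel {
  rpk_continuous : continuous (fun p : Omega * Omega => Phi p.1 p.2);
  rpk_symmetric : forall x y, Phi x y = Phi y x;
  rpk_radial : forall x y, Phi x y = phi (enorm (set_val x - set_val y));
  rpk_posdef : forall (m : nat) (x : 'I_m -> Omega), injective x ->
    posdefmx (kernel_mx Phi x) }.

Section native_space.
Context {R : realType} {T : Type}.
Implicit Types (f g h : T -> R) (H : set (T -> R)).
Implicit Types (ip : (T -> R) -> (T -> R) -> R).

Definition ip_norm ip f : R := Num.sqrt (ip f f).

(* A real Hilbert space of functions on [T]: the linear subspace [H] of
   [T -> R] with the inner product [ip]; the values of [ip] outside [H] are
   irrelevant. *)
Record hilbert_function_space H ip : Prop := HilbertFunctionSpace {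
  hfs_zero : H 0;
  hfs_linear : forall (a : R) f g, H f -> H g -> H (a *: f + g);
  hfs_ip_sym : forall f g, H f -> H g -> ip f g = ip g f;
  hfs_ip_linear : forall (a : R) f g h, H f -> H g -> H h ->
    ip (a *: f + g) h = a * ip f h + ip g h;
  hfs_ip_pos : forall f, H f -> f != 0 -> 0 < ip f f;
  hfs_complete : forall F : nat -> T -> R, (forall k, H (F k)) ->
    (forall e : R, 0 < e -> exists k0 : nat, forall k l : nat,
      (k0 <= k)%N -> (k0 <= l)%N -> ip_norm ip (F k - F l) < e) ->
    exists2 f, H f & ip_norm ip (F k - f) @[k --> \oo] --> (0 : R) }.

(* [H] with [ip] is the Hilbert space of functions on [T] with reproducing
   kernel [K]. By the Moore-Aronszajn theorem there is exactly one such space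
   for a positive definite [K]. *)
Record native_space (K : T -> T -> R) H ip : Prop := NativeSpace {
  ns_hilbert : hilbert_function_space H ip;
  ns_kernel : forall y, H (K^~ y);
  ns_reproducing : forall f y, H f -> f y = ip f (K^~ y) }.

Definition orthonormal_family H ip {N : nat} (u : 'I_N -> T -> R) : Prop :=
  (forall j, H (u j)) /\ forall i j, ip (u i) (u j) = (i == j)%:R.

End native_space.

Section cubature.
Context {R : realType} {T : Type} {N : nat}.
Implicit Types (x : 'I_N -> T) (w : 'I_N -> R) (f g : T -> R).

Definition cubature x w f : R := \sum_(j < N) w j * f (x j).

Definition l2w_ip x w f g : R := \sum_(i < N) w i * f (x i) * g (x i).

Definition l2w_norm x w f : R := Num.sqrt (l2w_ip x w f f).

End cubature.

Record cubature_rule {R : realType} {n : nat} (Omega : set 'rV[R]_n) {N : nat}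
    (x : 'I_N -> Omega) (w : 'I_N -> R) : Prop := CubatureRule {
  cub_distinct : injective x;
  cub_weights_pos : forall j, 0 < w j;
  cub_exact_constants : (\sum_(j < N) w j)%:E = lebesgue_outer Omega }.

Section weighted_svd.
Context {R : realType} {T : Type} {N : nat}.
Implicit Types (K : T -> T -> R) (x : 'I_N -> T) (w sigma : 'I_N -> R).

Definition sqrt_weight_mx w : 'M[R]_N := diag_mx (\row_i Num.sqrt (w i)).

Definition sigma_mx sigma : 'M[R]_N := diag_mx (\row_i sigma i).

Record weighted_svd K x w (Q : 'M[R]_N) sigma : Prop := WeightedSVD {
  wsvd_orthogonal : Q *m Q^T = 1%:M;
  wsvd_pos : forall j, 0 < sigma j;
  wsvd_sorted : forall i j : 'I_N, (i <= j)%N -> sigma j <= sigma i;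
  wsvd_decomposition :
    sqrt_weight_mx w *m kernel_mx K x *m sqrt_weight_mx w =
      Q *m (sigma_mx sigma *m sigma_mx sigma) *m Q^T }.

Definition wsvd_coef_mx w (Q : 'M[R]_N) sigma : 'M[R]_N :=
  sqrt_weight_mx w *m Q *m invmx (sigma_mx sigma).

Definition weighted_svd_basis K x w sigma (u : 'I_N -> T -> R) : Prop :=
  exists2 Q : 'M[R]_N, weighted_svd K x w Q sigma &
    forall j, u j = \sum_(i < N) wsvd_coef_mx w Q sigma i j *: (K^~ (x i)).

End weighted_svd.

(* Main.v *)
(* Entrywise, the decomposition and the orthogonality of Q say that
   sqrt (w i) * u j (x i) = sigma j * Q i j. So w i * u j (x i) is sigma j ^+ 2
   times the coefficient of Phi(., x i) in u j, which is the first claim; by the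
   reproducing property both Gram matrices of the basis reduce to Q^T Q = 1; and
   the last claim is the trace of the decomposition. *)
Require Import Defs.
From HB Require Import structures.
From mathcomp Require Import all_boot all_order all_algebra.
From mathcomp Require Import all_classical all_reals all_analysis.
From mathcomp Require Import ring.

Import Order.TTheory GRing.Theory Num.Theory.
Import numFieldNormedType.Exports.

Local Open Scope classical_set_scope.
Local Open Scope ring_scope.

Set Implicit Arguments.
Unset Strict Implicit.

Section hilbert_function_space_theory.
Context {R : realType} {T : Type}.
Variables (H : set (T -> R)) (ip : (T -> R) -> (T -> R) -> R).
Hypothesis hH : hilbert_function_space H ip.

Lemma hfs_ip0l (h : T -> R) : H h -> ip 0 h = 0.
Proof.
move=> Hh; have H0 := hfs_zero hH.
have := hfs_ip_linear hH 1 H0 H0 Hh.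
by rewrite scaler0 addr0 mul1r => /eqP; rewrite -subr_eq subrr eq_sym => /eqP.
Qed.

Lemma hfs_sum (I : Type) (s : seq I) (a : I -> R) (f : I -> T -> R) :
  (forall i, H (f i)) -> H (\sum_(i <- s) a i *: f i).
Proof.
move=> Hf; elim: s => [|i s IHs]; first by rewrite big_nil; exact: hfs_zero hH.
by rewrite big_cons; apply: (hfs_linear hH).
Qed.

Lemma hfs_ip_suml (I : Type) (s : seq I) (a : I -> R) (f : I -> T -> R)
    (h : T -> R) : (forall i, H (f i)) -> H h ->
  ip (\sum_(i <- s) a i *: f i) h = \sum_(i <- s) a i * ip (f i) h.
Proof.
move=> Hf Hh; elim: s => [|i s IHs]; first by rewrite !big_nil hfs_ip0l.
by rewrite !big_cons (hfs_ip_linear hH) ?IHs//; exact: hfs_sum.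
Qed.

End hilbert_function_space_theory.

(** Symmetry of [ip] and the reproducing property turn each pairing with [K^~ (x i)] into evaluation
    of [h] at [x i]. *)
Lemma native_space_ip_suml {R : realType} {T : Type} (K : T -> T -> R)
    (H : set (T -> R)) (ip : (T -> R) -> (T -> R) -> R) (I : Type) (s : seq I)
    (a : I -> R) (x : I -> T) (h : T -> R) : native_space K H ip -> H h ->
  ip (\sum_(i <- s) a i *: K^~ (x i)) h = \sum_(i <- s) a i * h (x i).
Proof.
move=> hH Hh; have HK i := ns_kernel hH (x i).
rewrite (hfs_ip_suml (ns_hilbert hH))//; apply: eq_bigr => i _.
by rewrite (ns_reproducing hH (x i) Hh) (hfs_ip_sym (ns_hilbert hH) (HK i) Hh).
Qed.

Section weighted_svd_theory.
Context {R : realType} {T : Type} {N : nat}.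
Variables (K : T -> T -> R) (x : 'I_N -> T) (w sigma : 'I_N -> R).
Variable Q : 'M[R]_N.
Hypotheses (w_gt0 : forall i, 0 < w i) (svd : weighted_svd K x w Q sigma).

Let sigma_gt0 j : 0 < sigma j := wsvd_pos svd j.
Let sigma_neq0 j : sigma j != 0 := lt0r_neq0 (sigma_gt0 j).
Let sqrtw_neq0 i : Num.sqrt (w i) != 0.
Proof. by rewrite gt_eqF ?sqrtr_gt0. Qed.
Let mul_sqrtw i : Num.sqrt (w i) * Num.sqrt (w i) = w i.
Proof. by have := sqr_sqrtr (ltW (w_gt0 i)); rewrite expr2. Qed.

Lemma invmx_sigma_mx :
  invmx (sigma_mx sigma) = sigma_mx (fun j => (sigma j)^-1).
Proof.
have E : sigma_mx sigma *m sigma_mx (fun j => (sigma j)^-1) = 1%:M.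
  rewrite mulmx_diag -diag_const_mx; congr diag_mx.
  by apply/rowP => j; rewrite !mxE divff.
have [U _] := mulmx1_unit E.
by rewrite -[RHS](mulKmx U) E mulmx1.
Qed.

Lemma wsvd_coefE i j :
  wsvd_coef_mx w Q sigma i j = Num.sqrt (w i) * Q i j / sigma j.
Proof. by rewrite /wsvd_coef_mx invmx_sigma_mx mul_mx_diag mul_diag_mx !mxE. Qed.

(** The hypothesis [Q *m Q^T = 1%:M] concerns rows; since [Q] is square, its right inverse is also a
    left inverse. *)
Lemma wsvd_orthonormal_cols i j : \sum_k Q k i * Q k j = (i == j)%:R.
Proof.
have /matrixP/(_ i j) := mulmx1C (wsvd_orthogonal svd).
by rewrite !mxE => <-; apply: eq_bigr => k _; rewrite mxE.
Qed.

(** Multiplying the decomposition by [Q] on the right cancels [Q^T *m Q] and leaves the eigenvector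
    equation for column [j] of [Q]. *)
Lemma wsvd_eigen i j :
  \sum_k Num.sqrt (w i) * K (x i) (x k) * Num.sqrt (w k) * Q k j =
  Q i j * sigma j ^+ 2.
Proof.
have /(congr1 (mulmx^~ Q)) := wsvd_decomposition svd.
rewrite -[RHS]mulmxA (mulmx1C (wsvd_orthogonal svd)) mulmx1.
rewrite mulmx_diag mul_mx_diag mul_mx_diag mul_diag_mx.
move=> /matrixP/(_ i j); rewrite !mxE expr2 => <-.
by apply: eq_bigr => k _; rewrite !mxE.
Qed.

(** Cyclicity of the trace removes [Q], and on the diagonal the two square roots merge into
    [w i]. *)
Lemma wsvd_trace : \sum_j sigma j ^+ 2 = \sum_i w i * K (x i) (x i).
Proof.
have /(congr1 mxtrace) := wsvd_decomposition svd.
rewrite [RHS]mxtrace_mulC [X in _ = \tr X]mulmxA.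
rewrite (mulmx1C (wsvd_orthogonal svd)) mul1mx.
rewrite mulmx_diag mul_mx_diag mul_diag_mx mxtrace_diag.
under [in X in _ = X -> _]eq_bigr do rewrite !mxE -[_ * _]/(_ ^+ 2).
by move=> <-; apply: eq_bigr => i _; rewrite !mxE mulrAC mul_sqrtw.
Qed.

Variable u : 'I_N -> T -> R.
Hypothesis uE : forall j,
  u j = \sum_(i < N) wsvd_coef_mx w Q sigma i j *: K^~ (x i).

Lemma wsvd_basisE j y :
  u j y = \sum_(i < N) wsvd_coef_mx w Q sigma i j * K y (x i).
Proof. by rewrite uE fct_sumE. Qed.

Lemma wsvd_basis_node i j : Num.sqrt (w i) * u j (x i) = sigma j * Q i j.
Proof.
(* The extra factor [sigma j] cancels the inverse in the coefficients of [u j]; what remains is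
   entry [i] of the eigenvector equation. *)
apply: (mulIf (sigma_neq0 j)).
transitivity (Q i j * sigma j ^+ 2); last by ring.
rewrite -wsvd_eigen wsvd_basisE mulr_sumr mulr_suml.
by apply: eq_bigr => k _; rewrite wsvd_coefE; field.
Qed.

(** Each weight splits into two square roots, one per factor, so the nodal identity reduces this
    Gram matrix to that of the columns of [Q]. It serves both the orthogonality and the norm
    claim. *)
Lemma wsvd_basis_l2w i j :
  l2w_ip x w (u i) (u j) = sigma i * sigma j * (i == j)%:R.
Proof.
rewrite -wsvd_orthonormal_cols mulr_sumr; apply: eq_bigr => k _.
by rewrite mulrACA -!wsvd_basis_node mulrACA mul_sqrtw mulrA.
Qed.

Lemma wsvd_basis_cubature j y :
  u j y = (sigma j ^+ 2)^-1 * \sum_(i < N) w i * u j (x i) * K y (x i).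
Proof.
rewrite {1}wsvd_basisE mulr_sumr; apply: eq_bigr => i _.
(* One root of [w i] is absorbed by the nodal identity; the other is the root already present in the
   coefficient. *)
rewrite -{1}mul_sqrtw -[_ * _ * u j (x i)]mulrA wsvd_basis_node wsvd_coefE.
by field; rewrite sigma_neq0.
Qed.

Lemma wsvd_basis_orthonormal (H : set (T -> R))
    (ip : (T -> R) -> (T -> R) -> R) :
  native_space K H ip -> orthonormal_family H ip u.
Proof.
move=> hH; have Hu j : H (u j).
  by rewrite uE; apply: (hfs_sum (ns_hilbert hH)) => i; exact: ns_kernel hH _.
(* Only [u i] is expanded, so that [u j] enters through its nodal values. *)
split=> // i j; rewrite {1}uE (native_space_ip_suml _ _ _ hH)//.
(* The coefficients of [u i] contribute [1 / sigma i], the nodal values of [u j] contribute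
   [sigma j], and the roots of the weights cancel. The quotient survives only for [i = j], where it
   is 1. *)
transitivity (sigma j / sigma i * (i == j)%:R).
  rewrite -wsvd_orthonormal_cols mulr_sumr; apply: eq_bigr => k _.
  have -> : u j (x k) = sigma j * Q k j / Num.sqrt (w k).
    by rewrite -wsvd_basis_node mulrC mulKf.
  by rewrite wsvd_coefE; field; rewrite sigma_neq0 sqrtw_neq0.
by have [->|_] := eqVneq i j; rewrite ?mulr0// divff ?mulr1.
Qed.

End weighted_svd_theory.

Unset Implicit Arguments.
Set Strict Implicit.

Theorem proposition3p1 (R : realType) (n : nat) (hn : (0 < n)%N)
  (Omega : set 'rV[R]_n)
  (hOmega_bounded : bounded_set Omega)
  (hOmega_measurable : lebesgue_measurable Omega)
  (phi : R -> R) (Phi : Omega -> Omega -> R)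
  (hPhi : radial_pd_kernel phi Phi)
  (H : set (Omega -> R)) (ip : (Omega -> R) -> (Omega -> R) -> R)
  (hH : native_space Phi H ip)
  (N : nat) (x : 'I_N -> Omega) (w : 'I_N -> R)
  (hcub : cubature_rule x w)
  (sigma : 'I_N -> R) (u : 'I_N -> Omega -> R)
  (hu : weighted_svd_basis Phi x w sigma u) :
  [/\ forall (j : 'I_N) (y : Omega),
        u j y = (sigma j ^+ 2)^-1 *
                \sum_(i < N) w i * u j (x i) * Phi y (x i) /\
        u j y = (sigma j ^+ 2)^-1 * cubature x w (fun z => Phi y z * u j z),
      orthonormal_family H ip u,
      forall i j : 'I_N, i != j -> l2w_ip x w (u i) (u j) = 0,
      forall j : 'I_N, l2w_norm x w (u j) ^+ 2 = sigma j ^+ 2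
    & (\sum_(j < N) sigma j ^+ 2)%:E = ((phi 0)%:E * lebesgue_outer Omega)%E ].
Proof.
have [Q svd uE] := hu; have w_gt0 := cub_weights_pos hcub.
split.
- move=> j y; have E := wsvd_basis_cubature w_gt0 svd uE j y.
  split=> //; rewrite {1}E; congr (_ * _); apply: eq_bigr => i _.
  by rewrite -mulrA (mulrC (u j _)).
- exact: (wsvd_basis_orthonormal w_gt0 svd uE hH).
- by move=> i j /negPf ij; rewrite (wsvd_basis_l2w w_gt0 svd uE) ij mulr0.
- move=> j; rewrite sqr_sqrtr (wsvd_basis_l2w w_gt0 svd uE) eqxx mulr1 -expr2//.
  (* This is nonnegativity under the root in [l2w_norm], with the radicand already evaluated. *)
  exact: sqr_ge0.
(* Exactness on constants replaces the measure of [Omega] by the total weight; radiality makes every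
   diagonal kernel value in the trace equal to [phi 0]. *)
- rewrite -(cub_exact_constants hcub) -EFinM (wsvd_trace w_gt0 svd) mulr_sumr.
  congr (_%:E); apply: eq_bigr => i _.
  rewrite mulrC (rpk_radial hPhi) subrr; congr (phi _ * _).
  by rewrite /enorm big1 ?sqrtr0// => k _; rewrite mxE expr0n.
Qed.
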